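(* Let $\mathfrak g_1,\mathfrak g_2$ be two $n$-triadons on the same $n$-dimensional vector space $V$, let $C_i$ be the center of $\mathfrak g_i$, and put $C_{12}=C_1\cap C_2$. If $\dim C_{12}\ge n-3$, then $\mathfrak g_1$ and $\mathfrak g_2$ are compatible.
   Context: The ground field $\mathbf k$ has characteristic zero. An $n$-triadon is a Lie algebra structure on an $n$-dimensional vector space isomorphic to the direct sum of the $3$-dimensional Heisenberg algebra ($[\varepsilon_1,\varepsilon_2]=\varepsilon_3$, $\varepsilon_3$ central) and the $(n-3)$-dimensional abelian Lie algebra. Two Lie algebra structures on $V$ are compatible if the sum of their brackets is a Lie bracket. *)

(* Defs.v *)
From HB Require Import structures.
From mathcomp Require Import all_boot all_algebra.
From mathcomp Require Import ring.

Set Implicit Arguments.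
Unset Strict Implicit.
Unset Printing Implicit Defensive.

Import GRing.Theory.
Local Open Scope ring_scope.

(* Alternation is required as [x, x] = 0 rather than as antisymmetry, so that  *)
(* the definition is the standard one over an arbitrary field.                *)
Definition is_lie_bracket (k : fieldType) (V : lmodType k) (b : V -> V -> V)
    : Prop :=
  [/\ forall x, linear (b x),
      forall y, linear (b ^~ y),
      forall x, b x x = 0
    & forall x y z, b x (b y z) + b y (b z x) + b z (b x y) = 0].

Record lie_structure (k : fieldType) (V : lmodType k) := LieStructure {
  bracket :> V -> V -> V;
  bracketP : is_lie_bracket bracket
}.

Definition lie_isomorphic (k : fieldType) (V W : lmodType k)
    (g : lie_structure V) (h : lie_structure W) : Prop :=
  exists2 f : {linear V -> W},
    bijective f & forall x y, f (g x y) = h (f x) (f y).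

Definition compatible (k : fieldType) (V : lmodType k)
    (g h : lie_structure V) : Prop :=
  is_lie_bracket (fun x y => g x y + h x y).

Section StandardLie.

Variable k : fieldType.

(* e_0, e_1, e_2 is the standard basis of k^3: the bracket is the bilinear    *)
(* alternating map with [e_0, e_1] = e_2 and e_2 central.                     *)
Definition heisenberg_bracket (x y : 'rV[k]_3) : 'rV[k]_3 :=
  (x 0 (inord 0) * y 0 (inord 1) - x 0 (inord 1) * y 0 (inord 0))
    *: delta_mx 0 (inord 2).

Lemma heisenberg_bracketP : is_lie_bracket heisenberg_bracket.
Proof.
have e0 : (inord 0 == inord 2 :> 'I_3) = false by rewrite -val_eqE /= !inordK.
have e1 : (inord 1 == inord 2 :> 'I_3) = false by rewrite -val_eqE /= !inordK.
split=> [x a y z|y a x z|x|x y z]; rewrite /heisenberg_bracket.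
- rewrite !mxE scalerA -scalerDl; congr (_ *: _).
  by ring.
- rewrite !mxE scalerA -scalerDl; congr (_ *: _).
  by ring.
- by rewrite [X in _ - X]mulrC subrr scale0r.
- by rewrite !mxE e0 e1 /= !mulr0 !subr0 !scale0r !addr0.
Qed.

Definition heisenberg : lie_structure 'rV[k]_3 :=
  LieStructure heisenberg_bracketP.

Lemma abelian_bracketP (V : lmodType k) :
  is_lie_bracket (fun _ _ : V => 0 : V).
Proof. by split=> [x a y z|y a x z|x|x y z]; rewrite ?scaler0 ?addr0. Qed.

Definition abelian_lie (V : lmodType k) : lie_structure V :=
  LieStructure (abelian_bracketP V).

Section DirectSum.

Variables (V W : lmodType k) (g : lie_structure V) (h : lie_structure W).

Definition lie_sum_bracket (x y : V * W) : V * W := (g x.1 y.1, h x.2 y.2).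

Lemma lie_sum_bracketP : is_lie_bracket lie_sum_bracket.
Proof.
have [gr gl ga gj] := bracketP g; have [hr hl ha hj] := bracketP h.
split=> [x a y z|y a x z|x|x y z]; rewrite /lie_sum_bracket; congr pair => //=.
- exact: gr.
- exact: hr.
- exact: gl.
- exact: hl.
Qed.

Definition lie_sum : lie_structure (V * W)%type :=
  LieStructure lie_sum_bracketP.

End DirectSum.

End StandardLie.

(* The truncated subtraction n - 3 is harmless: an isomorphism forces         *)
(* n = 3 + (n - 3), hence 3 <= n.                                             *)
Definition is_triadon (k : fieldType) (V : vectType k) (n : nat)
    (g : lie_structure V) : Prop :=
  \dim {:V} = n /\
  lie_isomorphic g (lie_sum (heisenberg k) (abelian_lie 'rV[k]_(n - 3))).

Section Center.

Variables (k : fieldType) (V : vectType k) (g : lie_structure V).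

Fact bracket_is_linear x : linear (g x).
Proof. by case: (bracketP g). Qed.

HB.instance Definition _ x :=
  GRing.isLinear.Build k V V *:%R (g x) (bracket_is_linear x).

Definition adjoint (x : V) : 'End(V) := linfun (g x).

Lemma adjointE x y : adjoint x y = g x y.
Proof. by rewrite lfunE. Qed.

Fact adjoint_is_linear : linear adjoint.
Proof.
have [_ gl _ _] := bracketP g.
move=> a u v; apply/lfunP => y.
by rewrite add_lfunE scale_lfunE !adjointE; apply: gl.
Qed.

HB.instance Definition _ :=
  GRing.isLinear.Build k V 'End(V) *:%R adjoint adjoint_is_linear.

Definition center : {vspace V} := lker (linfun adjoint).

Lemma centerP x : reflect (forall y, g x y = 0) (x \in center).
Proof.
rewrite memv_ker lfunE /=.
apply: (iffP eqP) => [gx0 y|gx0]; first by rewrite -adjointE gx0 zero_lfunE.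
by apply/lfunP => y; rewrite adjointE gx0 zero_lfunE.
Qed.

End Center.

(* Main.v *)
Require Import Defs.
From HB Require Import structures.
From mathcomp Require Import all_boot all_algebra.
From mathcomp Require Import ring.

(** A triadon has a bracket of the form [x, y] = w(x, y) v, where w is an
alternating bilinear form and v is a nonzero central vector; the center is then
the radical of w, so w(v, -) = 0.

Write the two brackets as w1 v1 and w2 v2.  The sum is bilinear and alternating,
and its Jacobi identity reduces to the vanishing of the mixed terms, that is, of
the cyclic sums of w1(y, z) w2(x, v1) and of w2(y, z) w1(x, v2).  The first of
these is, up to sign, the 3-form w1 /\ i_{v1} w2.  Contraction is an
antiderivation and i_{v1} w1 = 0, so this 3-form equals i_{v1} (w1 /\ w2)
([contract_wedge]).

The 4-form w1 /\ w2 is zero.  It descends to V / C12, where C12 is the common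
center, and that quotient has dimension at most 3; so its four arguments are
always linearly dependent modulo C12, and an alternating form vanishes on
dependent arguments ([wedge_eq0]).  The other mixed term vanishes by exchanging
the two structures. *)

Set Implicit Arguments.
Unset Strict Implicit.
Unset Printing Implicit Defensive.

Import GRing.Theory.
Local Open Scope ring_scope.

Definition alternating_form (k : fieldType) (V : lmodType k)
    (w : V -> V -> k) : Prop :=
  [/\ forall a x y z, w (a *: x + y) z = a * w x z + w y z,
      forall a x y z, w x (a *: y + z) = a * w x y + w x z
    & forall x, w x x = 0].

Section AlternatingForm.

Variables (k : fieldType) (V : lmodType k) (w : V -> V -> k).
Hypothesis w_alt : alternating_form w.

Lemma alternating_skew x y : w x y = - w y x.
Proof.
have [wl wr w0] := w_alt.
have := w0 (1 *: x + y); rewrite wl !wr !w0 !mul1r add0r addr0.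
by move/eqP; rewrite addr_eq0 => /eqP.
Qed.

Lemma alternating_comb_r x p q y z :
  w x (p *: y + q *: z) = p * w x y + q * w x z.
Proof.
have [_ wr w0] := w_alt.
have wx0 : w x 0 = 0 by rewrite -(subrr x) -scaleN1r addrC wr w0 mulr0 addr0.
by rewrite wr -[q *: z]addr0 wr wx0 addr0.
Qed.

End AlternatingForm.

(** The exterior product of two 2-forms: the sum over the (2,2)-shuffles. *)
Definition wedge (k : fieldType) (V : lmodType k) (w1 w2 : V -> V -> k)
    (a b c d : V) : k :=
  w1 a b * w2 c d - w1 a c * w2 b d + w1 a d * w2 b c
  + w1 b c * w2 a d - w1 b d * w2 a c + w1 c d * w2 a b.

Section Wedge.

Variables (k : fieldType) (V : vectType k) (w1 w2 : V -> V -> k).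
Hypotheses (w1_alt : alternating_form w1) (w2_alt : alternating_form w2).

Lemma wedge_is_linear b c d :
  linear (fun a => wedge w1 w2 a b c d : k^o).
Proof.
have [w1l _ _] := w1_alt; have [w2l _ _] := w2_alt.
move=> t x y; rewrite /wedge !w1l !w2l.
change (t *: (?u : k^o)) with (t * u); ring.
Qed.

Lemma wedge_swap a b c d : wedge w1 w2 b a c d = - wedge w1 w2 a b c d.
Proof.
rewrite /wedge (alternating_skew w1_alt b a) (alternating_skew w2_alt b a).
ring.
Qed.

Lemma wedge_move3 a b c d : wedge w1 w2 c a b d = wedge w1 w2 a b c d.
Proof.
rewrite /wedge (alternating_skew w1_alt c a) (alternating_skew w2_alt c a).
rewrite (alternating_skew w1_alt c b) (alternating_skew w2_alt c b); ring.
Qed.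

Lemma wedge_move4 a b c d : wedge w1 w2 d a b c = - wedge w1 w2 a b c d.
Proof.
rewrite /wedge (alternating_skew w1_alt d a) (alternating_skew w2_alt d a).
rewrite (alternating_skew w1_alt d b) (alternating_skew w2_alt d b).
rewrite (alternating_skew w1_alt d c) (alternating_skew w2_alt d c); ring.
Qed.

Lemma wedge_repeat a c d : wedge w1 w2 a a c d = 0.
Proof.
have [_ _ w1x] := w1_alt; have [_ _ w2x] := w2_alt.
rewrite /wedge w1x w2x; ring.
Qed.

(** In i_v (w1 /\ w2) = i_v w1 /\ w2 + w1 /\ i_v w2 the first summand is zero;
the left-hand side below is the second one, with v in the other slot of w2. *)
Lemma contract_wedge v x y z : (forall u, w1 v u = 0) ->
  w1 y z * w2 x v + w1 z x * w2 y v + w1 x y * w2 z v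
  = - wedge w1 w2 v x y z.
Proof.
move=> wv0; rewrite /wedge !wv0 (alternating_skew w1_alt z x).
rewrite (alternating_skew w2_alt x v) (alternating_skew w2_alt y v).
rewrite (alternating_skew w2_alt z v); ring.
Qed.

Variable U : {vspace V}.
Hypotheses (radU1 : forall u, u \in U -> forall x, w1 u x = 0)
           (radU2 : forall u, u \in U -> forall x, w2 u x = 0).

(** The vectors a at which the linear form wedge w1 w2 - b c d vanishes form a
subspace; it contains b, c and d because w1 /\ w2 is alternating, and it contains
U because U lies in both radicals. *)
Lemma wedge_dep a b c d :
  a \in (<[b]> + (<[c]> + (<[d]> + U)))%VS -> wedge w1 w2 a b c d = 0.
Proof.
pose hL := GRing.isLinear.Build k V k^o *:%R _ (wedge_is_linear b c d).
pose L : {linear V -> k^o} := HB.pack (fun a => wedge w1 w2 a b c d : k^o) hL.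
have kerE u : (u \in lker (linfun L)) = (wedge w1 w2 u b c d == 0).
  by rewrite memv_ker lfunE.
suff /subvP sub : (<[b]> + (<[c]> + (<[d]> + U)) <= lker (linfun L))%VS.
  by move/sub; rewrite kerE => /eqP.
rewrite !subv_add -!memvE !kerE wedge_repeat -(wedge_move3 c b c) wedge_repeat.
rewrite -[wedge _ _ d b c d]opprK -wedge_move4 wedge_repeat oppr0 eqxx /=.
apply/subvP=> u uU; rewrite kerE /wedge !(radU1 uU) !(radU2 uU).
by apply/eqP; ring.
Qed.

Lemma dim_add_line (W : {vspace V}) x :
  x \notin W -> \dim (<[x]> + W) = (\dim W).+1.
Proof.
move=> xW; rewrite dimv_disjoint_sum.
  rewrite dim_vline; case: eqP xW => [->|_ _]; last by rewrite add1n.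
  by rewrite mem0v.
apply/eqP; rewrite -subv0; apply/subvP=> y.
rewrite memv_cap memv0 => /andP[/vlineP[t ->]].
by rewrite rpredZeq (negPf xW) orbF => /eqP->; rewrite scale0r.
Qed.

(** A nonzero value at (a, b, c, d) would make the dimension grow by one each
time d, c, b and a are successively adjoined to U. *)
Lemma wedge_eq0 (codimU : (\dim {:V} <= \dim U + 3)%N) a b c d :
  wedge w1 w2 a b c d = 0.
Proof.
have [aS|aS] := boolP (a \in (<[b]> + (<[c]> + (<[d]> + U)))%VS).
  exact: wedge_dep.
have [bS|bS] := boolP (b \in (<[c]> + (<[d]> + U))%VS).
  apply/eqP; rewrite -oppr_eq0 -wedge_swap; apply/eqP/wedge_dep.
  exact: subvP (addvSr _ _) _ bS.
have [cS|cS] := boolP (c \in (<[d]> + U)%VS).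
  rewrite -wedge_move3; apply: wedge_dep.
  by apply: subvP (addvSr _ _) _ _; apply: subvP (addvSr _ _) _ cS.
have [dS|dS] := boolP (d \in U).
  apply/eqP; rewrite -oppr_eq0 -wedge_move4; apply/eqP/wedge_dep.
  apply: subvP (addvSr _ _) _ _; apply: subvP (addvSr _ _) _ _.
  exact: subvP (addvSr _ _) _ dS.
have := dimvS (subvf (<[a]> + (<[b]> + (<[c]> + (<[d]> + U))))).
move/leq_trans/(_ codimU).
by rewrite !dim_add_line // addn3 ltnn.
Qed.

End Wedge.

(** Transport of the Heisenberg bracket: v is the image of e_2, and w(x, y) is
the 2 x 2 minor of the coordinates of x and y along e_0 and e_1. *)
Lemma triadon_form (k : fieldType) (V : vectType k) (n : nat)
    (g : lie_structure V) : is_triadon n g ->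
  exists w : V -> V -> k, exists v : V,
    [/\ alternating_form w, forall x y, g x y = w x y *: v,
        forall y, w v y = 0
      & forall u, u \in center g -> forall y, w u y = 0].
Proof.
case=> _ [f [f' fK f'K] fg].
pose i0 : 'I_3 := inord 0; pose i1 : 'I_3 := inord 1; pose i2 : 'I_3 := inord 2.
have i02 : (i0 == i2) = false by rewrite -val_eqE /= !inordK.
have i12 : (i1 == i2) = false by rewrite -val_eqE /= !inordK.
pose w x y := (f x).1 0 i0 * (f y).1 0 i1 - (f x).1 0 i1 * (f y).1 0 i0.
pose v := f' (delta_mx 0 i2, 0).
have gE x y : g x y = w x y *: v.
  apply: (can_inj fK); rewrite fg linearZ /= f'K /lie_sum_bracket /=.
  by congr pair; rewrite scaler0.
have v0 : v != 0.
  apply/eqP=> v0; have fv0 : f v = 0 by rewrite v0 linear0.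
  have : (f v).1 0 i2 = 0 by rewrite fv0 mxE.
  by rewrite f'K !mxE !eqxx => /eqP; rewrite oner_eq0.
exists w, v; split=> //.
- split=> [a x y z|a x y z|x]; rewrite /w ?linearP /= ?mxE; ring.
- by move=> y; rewrite /w f'K /= !mxE i02 i12 /= !mul0r subrr.
- move=> u /centerP uC y; apply/eqP; move/eqP: (uC y).
  by rewrite gE scaler_eq0 (negPf v0) orbF.
Qed.

(** With brackets w1 v1 and w2 v2, this sum is the coefficient of v2 in the cross
terms of the Jacobi identity for their sum. *)
Lemma mixed_jacobi (k : fieldType) (V : vectType k) (w1 w2 : V -> V -> k)
    (v1 : V) (U : {vspace V}) :
  alternating_form w1 -> alternating_form w2 -> (forall y, w1 v1 y = 0) ->
  (forall u, u \in U -> forall y, w1 u y = 0) ->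
  (forall u, u \in U -> forall y, w2 u y = 0) ->
  (\dim {:V} <= \dim U + 3)%N ->
  forall x y z, w1 y z * w2 x v1 + w1 z x * w2 y v1 + w1 x y * w2 z v1 = 0.
Proof.
move=> a1 a2 wv r1 r2 dU x y z.
by rewrite contract_wedge // (wedge_eq0 a1 a2 r1 r2 dU) oppr0.
Qed.

Theorem lemma6p2 (k : fieldType) (k_char0 : [pchar k]%R =i pred0)
    (V : vectType k) (n : nat) (g1 g2 : lie_structure V)
    (tri1 : is_triadon n g1) (tri2 : is_triadon n g2)
    (dimC12 : (n - 3 <= \dim (center g1 :&: center g2))%N) :
  compatible g1 g2.
Proof.
have [w1 [v1 [a1 g1E wv1 r1]]] := triadon_form tri1.
have [w2 [v2 [a2 g2E wv2 r2]]] := triadon_form tri2.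
have codim : (\dim {:V} <= \dim (center g1 :&: center g2) + 3)%N.
  by case: tri1 => -> _; rewrite addnC -leq_subLR.
have rad1 u : u \in (center g1 :&: center g2)%VS -> forall y, w1 u y = 0.
  by rewrite memv_cap => /andP[/r1].
have rad2 u : u \in (center g1 :&: center g2)%VS -> forall y, w2 u y = 0.
  by rewrite memv_cap => /andP[_ /r2].
have mix12 := mixed_jacobi a1 a2 wv1 rad1 rad2 codim.
have mix21 := mixed_jacobi a2 a1 wv2 rad2 rad1 codim.
have [lr1 ll1 alt1 _] := bracketP g1; have [lr2 ll2 alt2 _] := bracketP g2.
split=> [x a y z|y a x z|x|x y z].
- by rewrite lr1 lr2 scalerDr addrACA.
- by rewrite (ll1 y) (ll2 y) scalerDr addrACA.
- by rewrite alt1 alt2 addr0.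
have jacobi_term a b c :
    g1 a (g1 b c + g2 b c) + g2 a (g1 b c + g2 b c)
    = (w2 b c * w1 a v2) *: v1 + (w1 b c * w2 a v1) *: v2.
  rewrite !g1E !g2E (alternating_comb_r a1) (alternating_comb_r a2).
  rewrite (alternating_skew a1 a v1) (alternating_skew a2 a v2) wv1 wv2.
  by rewrite oppr0 !mulr0 add0r addr0.
rewrite !jacobi_term (addrACA (_ *: _)) (addrACA (_ + _)) -!scalerDl.
by rewrite mix12 mix21 !scale0r addr0.
Qed.
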